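(* Let $B\in\mathbb R^{d_x\times d_y}$ be a nonzero matrix with largest singular value $L_{xy}$, let $f(x,y)=x^\top By$, and let $\gamma,\delta\ge0$. There exist step sizes $\alpha,\beta>0$ for which Alex-GDA with parameters $\gamma,\delta$ applied to $f$ converges linearly to a Nash equilibrium of $f$ from every initialization if and only if $\gamma+\delta>2$. Moreover, if $\gamma+\delta>2$, then step sizes $\alpha,\beta>0$ have this convergence property if and only if $$\begin{cases}\alpha\beta<\dfrac{4}{(2\gamma-1)(2\delta-1)L_{xy}^2}, & \text{if } 4\gamma\delta-3(\gamma+\delta)+2\ge0,\\[2ex] \alpha\beta<\dfrac{\gamma+\delta-2}{-(\gamma-1)(\delta-1)(\gamma+\delta-1)L_{xy}^2}, & \text{if } 4\gamma\delta-3(\gamma+\delta)+2<0.\end{cases}$$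
   Context: Alex-GDA with step sizes $\alpha,\beta>0$ and parameters $\gamma,\delta\ge0$ applied to $f:\mathbb R^{d_x}\times\mathbb R^{d_y}\to\mathbb R$: start from $(x_0,y_0)$ with $\tilde y_0=y_0$, and for $k\ge0$: $x_{k+1}=x_k-\alpha\nabla_xf(x_k,\tilde y_k)$, $\tilde x_{k+1}=x_k-\gamma\alpha\nabla_xf(x_k,\tilde y_k)$, $y_{k+1}=y_k+\beta\nabla_yf(\tilde x_{k+1},y_k)$, $\tilde y_{k+1}=y_k+\delta\beta\nabla_yf(\tilde x_{k+1},y_k)$. A Nash equilibrium of $f$ is a point $(x_\star,y_\star)$ with $f(x_\star,y)\le f(x_\star,y_\star)\le f(x,y_\star)$ for all $x,y$; for $f(x,y)=x^\top By$ these are exactly the points with $B^\top x_\star=0$ and $By_\star=0$. Linear convergence to a Nash equilibrium means: there is a Nash equilibrium $z_\star$ (possibly depending on the initialization) and constants $M\ge0$, $\rho\in[0,1)$ with $\|(x_k,y_k)-z_\star\|\le M\rho^k$ for all $k$. *)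

(* Defs.v *)
From HB Require Import structures.
From mathcomp Require Import all_boot all_order all_algebra.
From mathcomp Require Import all_classical all_reals all_analysis.
Set Implicit Arguments.
Unset Strict Implicit.
Unset Printing Implicit Defensive.
Import Order.TTheory GRing.Theory Num.Theory.
Import numFieldNormedType.Exports.
Local Open Scope ring_scope.

Section AlexGDA.
Variable R : realType.

(* Vectors of R^n are column vectors.  The norm that the library puts on
   matrices is the max norm, hence the explicit Euclidean norm. *)
Definition euclidean_norm n (v : 'cV[R]_n) : R :=
  Num.sqrt (\sum_i v i ord0 ^+ 2).

Definition gradient n (g : 'cV[R]_n -> R) (x : 'cV[R]_n) : 'cV[R]_n :=
  \col_i 'D_(delta_mx i ord0) (g : 'cV[R]_n -> R^o) x.

Section Game.
Variables (dx dy : nat).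
Implicit Types (f : 'cV[R]_dx -> 'cV[R]_dy -> R).

Definition gradient_x f x y : 'cV[R]_dx := gradient (fun u => f u y) x.

Definition gradient_y f x y : 'cV[R]_dy := gradient (fun v => f x v) y.

Definition nash_equilibrium f (x : 'cV[R]_dx) (y : 'cV[R]_dy) : Prop :=
  (forall v, f x v <= f x y) /\ (forall u, f x y <= f u y).

(* The state after k steps is (x_k, y_k, ytilde_k); the point xtilde_(k+1) is
   only used inside the step that produces it. *)
Definition alex_gda_step f (gamma delta alpha beta : R)
    (s : 'cV[R]_dx * 'cV[R]_dy * 'cV[R]_dy) :=
  let: (x, y, yt) := s in
  let gx := gradient_x f x yt in
  let xt := x - (gamma * alpha) *: gx in
  let gy := gradient_y f xt y in
  (x - alpha *: gx, y + beta *: gy, y + (delta * beta) *: gy).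

Definition alex_gda f (gamma delta alpha beta : R) x0 y0 (k : nat) :=
  iter k (alex_gda_step f gamma delta alpha beta) (x0, y0, y0).

Definition linearly_converges_to_nash f (gamma delta alpha beta : R) x0 y0 :
    Prop :=
  exists (xs : 'cV[R]_dx) (ys : 'cV[R]_dy), nash_equilibrium f xs ys /\
  exists M rho : R, [/\ 0 <= M, 0 <= rho, rho < 1 &
    forall k : nat,
      let: (x, y, _) := alex_gda f gamma delta alpha beta x0 y0 k in
      euclidean_norm (col_mx (x - xs) (y - ys)) <= M * rho ^+ k].

Definition globally_linearly_converges f (gamma delta alpha beta : R) : Prop :=
  forall (x0 : 'cV[R]_dx) (y0 : 'cV[R]_dy),
    linearly_converges_to_nash f gamma delta alpha beta x0 y0.

Definition bilinear_game (B : 'M[R]_(dx, dy))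
    (x : 'cV[R]_dx) (y : 'cV[R]_dy) : R :=
  (x^T *m B *m y) ord0 ord0.

(* If dx < dy this also counts the dy - dx zero eigenvalues of B^T B, which
   does not affect the largest singular value of a nonzero B. *)
Definition singular_value (B : 'M[R]_(dx, dy)) (s : R) : Prop :=
  exists2 a : R, eigenvalue (B^T *m B) a & s = Num.sqrt a.

Definition largest_singular_value (B : 'M[R]_(dx, dy)) (L : R) : Prop :=
  singular_value B L /\ (forall s, singular_value B s -> s <= L).

End Game.
End AlexGDA.

(* Main.v *)
(** Along a pair of singular vectors with singular value sigma > 0, Alex-GDA is
    a linear recurrence in dimension 3 which depends only on gamma, delta and
    s = alpha beta sigma^2; its characteristic polynomial p is a real cubic.

    Sufficiency: the Schur-Cohn-Jury conditions place the complex roots of p in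
    the open unit disc, so that each mode is the solution of three nested first
    order recurrences and decays.  The conditions are monotone in s, hence the
    largest singular value decides.  If B = F B^T B, then x_k - F B^T x_k does
    not depend on k, so that decay of the modes of B^T x_k is decay of
    x_k - x_star with the limit x_star = x_0 - F B^T x_0; likewise for y.

    Necessity: when one of the conditions fails, the modal matrix, its second
    or its third exterior power has a real eigenvalue of modulus at least 1,
    and a left eigenvector gives a linear form, an antisymmetric form or a
    determinant of trajectories that does not tend to 0. *)
Require Import Defs.
From mathcomp Require Import all_boot all_order all_algebra.
From mathcomp Require Import all_classical all_reals all_analysis.
From mathcomp Require Import complex ring lra.
Import Order.TTheory GRing.Theory Num.Theory.
Import numFieldNormedType.Exports.
Set Implicit Arguments.
Unset Strict Implicit.
Unset Printing Implicit Defensive.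
Local Open Scope ring_scope.

(** * Geometric decay of sequences *)

Section Decay.
Variable K : numFieldType.
Implicit Types (w v : nat -> K) (a : K).

Definition decays w : Prop := exists M rho : K,
  [/\ 0 <= M, 0 <= rho, rho < 1 & forall k, `|w k| <= M * rho ^+ k].

Lemma eq_decays w v : w =1 v -> decays w -> decays v.
Proof.
move=> e [M [r [M0 r0 r1 h]]]; exists M, r; split=> // k.
by rewrite -e.
Qed.

Lemma decays0 : decays (fun=> 0).
Proof. by exists 0, 0; split=> // k; rewrite normr0 mul0r. Qed.

(** The common rate is [1 - (1 - r) * (1 - t)]: it is at least [r] and [t], still below 1, and
    avoids a maximum in the partially ordered [K]. *)
Lemma decaysD w v : decays w -> decays v -> decays (fun k => w k + v k).
Proof.
move=> [M [r [M0 r0 r1 h]]] [N [t [N0 t0 t1 g]]].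
have rt : r <= r + t - r * t.
  have -> : r + t - r * t = r + t * (1 - r) by ring.
  by rewrite lerDl mulr_ge0 // subr_ge0 ltW.
have tr : t <= r + t - r * t.
  have -> : r + t - r * t = t + r * (1 - t) by ring.
  by rewrite lerDl mulr_ge0 // subr_ge0 ltW.
have q0 : 0 <= r + t - r * t := le_trans r0 rt.
exists (M + N), (r + t - r * t); split=> //; first exact: addr_ge0.
  have -> : r + t - r * t = 1 - (1 - r) * (1 - t) by ring.
  by rewrite gtrBl mulr_gt0 // subr_gt0.
move=> k; apply: le_trans (ler_normD _ _) _; rewrite mulrDl; apply: lerD.
  by apply: le_trans (h k) _; rewrite ler_wpM2l // lerXn2r.
by apply: le_trans (g k) _; rewrite ler_wpM2l // lerXn2r.
Qed.

Lemma decaysZ a w : decays w -> decays (fun k => a * w k).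
Proof.
move=> [M [r [M0 r0 r1 h]]]; exists (`|a| * M), r.
by split=> // [|k]; rewrite ?mulr_ge0 // normrM -mulrA ler_wpM2l.
Qed.

Lemma decaysM w v : decays w -> decays v -> decays (fun k => w k * v k).
Proof.
move=> [M [r [M0 r0 r1 h]]] [N [t [N0 t0 t1 g]]].
exists (M * N), (r * t); split; rewrite ?mulr_ge0 ?mulr_ilt1 // => k.
by rewrite normrM exprMn mulrACA ler_pM.
Qed.

Lemma decays_sum (I : Type) (s : seq I) (w : I -> nat -> K) :
  (forall i, decays (w i)) -> decays (fun k => \sum_(i <- s) w i k).
Proof.
move=> h; elim: s => [|i s ih].
  by apply: eq_decays decays0 => k; rewrite big_nil.
by apply: eq_decays (decaysD (h i) ih) => k; rewrite big_cons.
Qed.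

Lemma decays_shift w : decays w -> decays (fun k => w k.+1).
Proof.
move=> [M [r [M0 r0 r1 h]]]; exists (M * r), r; split; rewrite ?mulr_ge0 // =>
  k.
by rewrite -mulrA -exprS.
Qed.

(** A rate [q] with [r <= q] and [|a| < q] strictly also covers the resonant case [|a| = r]. The
    induction closes once [N * (q - |a|)] dominates [M]. *)
Lemma decays_first_order a w v : `|a| < 1 ->
  (forall k, w k.+1 = a * w k + v k) -> decays v -> decays w.
Proof.
move=> a1 ew [M [r [M0 r0 r1 h]]].
(* The product is at most each of its factors; halving it makes [e] strictly smaller than
   [1 - |a|]. *)
pose e := (1 - `|a|) * (1 - r) / 2.
have ha : 0 < 1 - `|a| by rewrite subr_gt0.
have hr : 0 < 1 - r by rewrite subr_gt0.
have e0 : 0 < e by rewrite divr_gt0 ?mulr_gt0.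
have e2 : e + e = (1 - `|a|) * (1 - r) by rewrite /e -splitr.
have ea : e < 1 - `|a|.
  apply: (@lt_le_trans _ _ (e + e)); first by rewrite ltrDl.
  by rewrite e2 ger_pMr // gerBl.
have er : e <= 1 - r.
  apply: (@le_trans _ _ (e + e)); first by rewrite lerDl ltW.
  by rewrite e2 ger_pMl // gerBl.
pose q := 1 - e.
have rq : r <= q by rewrite lerBrDl -lerBrDr.
have aq : 0 < q - `|a| by rewrite subr_gt0 ltrBrDl -ltrBrDr.
have q0 : 0 <= q := le_trans r0 rq.
pose N := `|w 0%N| + M / (q - `|a|).
have N0 : 0 <= N by rewrite addr_ge0 // divr_ge0 // ltW.
have MN : M <= N * (q - `|a|).
  by rewrite mulrDl mulfVK ?gt_eqF // lerDr mulr_ge0 // ltW.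
exists N, q; split=> //; first by rewrite gtrBl.
elim=> [|k ih]; first by rewrite expr0 mulr1 lerDl divr_ge0 // ltW.
rewrite ew; apply: le_trans (ler_normD _ _) _.
have -> : N * q ^+ k.+1 = `|a| * (N * q ^+ k) + N * (q - `|a|) * q ^+ k.
  by rewrite exprS; ring.
apply: lerD; first by rewrite normrM ler_wpM2l.
apply: le_trans (h k) _; apply: (@le_trans _ _ (M * q ^+ k)).
  by rewrite ler_wpM2l // lerXn2r.
by rewrite ler_wpM2r // exprn_ge0.
Qed.

End Decay.

Lemma decays_norm (K : numFieldType) (w : nat -> K) : decays w ->
  decays (fun k => `|w k|).
Proof.
by move=> [M [r [M0 r0 r1 h]]]; exists M, r; split=> // k; rewrite normr_id.
Qed.

Lemma le_decays (K : numFieldType) (w v : nat -> K) :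
  (forall k, `|w k| <= `|v k|) -> decays v -> decays w.
Proof.
move=> wv [M [r [M0 r0 r1 h]]]; exists M, r; split=> // k.
exact: le_trans (wv k) (h k).
Qed.

(** [|w k|] is nondecreasing, so [|w 0|] lies below a geometric sequence that tends to 0. *)
Lemma decays_geometric_eq0 (R : realType) (w : nat -> R) (a : R) :
  1 <= `|a| -> (forall k, w k.+1 = a * w k) -> decays w -> w 0%N = 0.
Proof.
move=> a1 ew [M [r [M0 r0 r1 h]]]; apply/normr0_eq0/le_anti/andP; split=> //.
have wk k : `|w 0%N| <= `|w k|.
  elim: k => // k ih; apply: le_trans ih _.
  by rewrite ew normrM ler_peMl.
have Mr : (geometric M r @ \oo --> (0 : R))%classic.
  by apply: cvg_geometric; rewrite ger0_norm.
by apply: (cvgr_to_ge Mr); apply: nearW => k; apply: le_trans (wk k) (h k).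
Qed.

Lemma decays_complex (R : rcfType) (w : nat -> R) :
  decays (fun k => (w k)%:C%C) -> decays w.
Proof.
move=> [M [r [M0 r0 r1 h]]].
have [M' eM] := complex_realP M (ger0_real M0).
have [r' er] := complex_realP r (ger0_real r0).
subst M r; rewrite ler0c in M0; rewrite ler0c in r0.
rewrite -[1]/(1%:C%C) ltcR in r1.
exists M', r'; split=> // k; have := h k.
by rewrite normc_def /= expr0n addr0 sqrtr_sqr -rmorphXn -rmorphM lecR.
Qed.

(** * Roots of real cubics in the unit disc *)

(** The hypotheses are the Jury conditions: p(1) > 0, p(-1) < 0, product of the roots of modulus
    less than 1, and positive product of the 1 - l_i l_j over pairs of roots. *)
Lemma real_cubic_root_gtN1 (R : realFieldType) (a2 a1 a0 l : R) :
  0 < 1 + a2 + a1 + a0 -> a2 + a0 < 1 + a1 -> `|a0| < 1 ->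
  0 < 1 - a1 + a0 * a2 - a0 ^+ 2 ->
  l ^+ 3 + a2 * l ^+ 2 + a1 * l + a0 = 0 -> -1 < l.
Proof.
move=> p1 pN1 /ltr_normlP[a0N a0P] D pl; rewrite ltNge; apply/negP => lN1.
(* The cubic is (X - l)(X^2 + b X + d). *)
pose b := a2 + l; pose d := a1 + l * b.
have e2 : a2 = b - l by rewrite /b; ring.
have e1 : a1 = d - l * b by rewrite /d; ring.
have e0 : a0 = - (l * d).
  by apply/eqP; rewrite -subr_eq0 -[X in _ == X]pl; apply/eqP; rewrite /d /b;
    ring.
clearbody b d; subst a2 a1 a0.
have l1 : l < -1.
  rewrite lt_neqAle lN1 andbT; apply/eqP => el; move: pN1; rewrite el; lra.
have b1 : 0 < 1 + b + d.
  rewrite -(pmulr_rgt0 _ (_ : 0 < 1 - l)); last by lra.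
  by have -> : (1 - l) * (1 + b + d) = 1 + (b - l) + (d - l * b) - l * d
    by ring.
have b2 : 0 < b - 1 - d.
  rewrite -(pmulr_rgt0 _ (_ : 0 < - 1 - l)); last by lra.
  have -> : (-1 - l) * (b - 1 - d) = 1 + (d - l * b) - (b - l + - (l * d))
    by ring.
  by rewrite subr_gt0.
have d1 : d < 1 by nra.
(* This is the product over pairs of roots. As [d < 1], its second factor must be positive; but
   [b > 1 + d] and [l < -1] put that factor below (1 + l)(1 + l d) < 0. *)
have : 0 < (1 - d) * (1 + l * b + l ^+ 2 * d).
  by move: D; congr (0 < _); ring.
rewrite pmulr_rgt0; last by lra.
have : 0 < (-1 - l) * (1 + l * d) by rewrite mulr_gt0; lra.
nra.
Qed.

(** The substitution of -X for X exchanges the conditions at 1 and -1 and preserves the other two,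
    so the bound [-1 < l] also applies to [- l]. *)
Lemma real_cubic_root_norm_lt1 (R : realFieldType) (a2 a1 a0 l : R) :
  0 < 1 + a2 + a1 + a0 -> a2 + a0 < 1 + a1 -> `|a0| < 1 ->
  0 < 1 - a1 + a0 * a2 - a0 ^+ 2 ->
  l ^+ 3 + a2 * l ^+ 2 + a1 * l + a0 = 0 -> `|l| < 1.
Proof.
move=> p1 pN1 ha0 D pl; rewrite ltr_norml (real_cubic_root_gtN1 p1 pN1) //=.
rewrite -ltrN2; apply: (@real_cubic_root_gtN1 _ (- a2) a1 (- a0)).
- lra.
- lra.
- by rewrite normrN.
- by rewrite mulrNN sqrrN.
- by rewrite -[RHS]oppr0 -[in RHS]pl; ring.
Qed.

(** A non-real root z comes with its conjugate and a real root r, and the product over pairs becomes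
    (1 - |z|^2) |1 - r z|^2; its positivity forces |z| < 1. *)
Lemma cubic_root_norm_lt1 (R : rcfType) (a2 a1 a0 : R) (z : R[i]) :
  0 < 1 + a2 + a1 + a0 -> a2 + a0 < 1 + a1 -> `|a0| < 1 ->
  0 < 1 - a1 + a0 * a2 - a0 ^+ 2 ->
  z ^+ 3 + a2%:C%C * z ^+ 2 + a1%:C%C * z + a0%:C%C = 0 -> `|z| < 1.
Proof.
move=> p1 pN1 ha0 D; case: z => x y.
rewrite !exprS expr0 !mulr1 => /eqP; rewrite eq_complex /= =>
  /andP[/eqP hRe /eqP hIm].
rewrite -[1]/(1%:C%C) normc_def ltcR /= -[ltRHS]sqrtr1 ltr_sqrt //.
case: (eqVneq y 0) hRe hIm => [-> hRe _|y0 hRe hIm].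
  have xl : `|x| < 1.
    by apply: (real_cubic_root_norm_lt1 p1 pN1 ha0 D); rewrite -[RHS]hRe; ring.
  by rewrite expr0n addr0 -(real_normK (num_real x)) expr_lt1.
pose d := x ^+ 2 + y ^+ 2; pose r := - (a2 + 2 * x).
have e1 : a1 = d + 2 * x * r.
  apply: (mulfI y0); apply/eqP; rewrite -subr_eq0 -[X in _ == X]hIm.
  by apply/eqP; rewrite /d /r; ring.
have e2 : a2 = - r - 2 * x by rewrite /r; ring.
have e0 : a0 = - (r * d).
  apply/eqP; rewrite -subr_eq0 -[X in _ == X]hRe e1.
  by apply/eqP; rewrite /d /r; ring.
have : 0 < (1 - d) * ((1 - r * x) ^+ 2 + (r * y) ^+ 2).
  move: D; rewrite e0 e1 e2; congr (0 < _); rewrite /d; ring.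
rewrite -/d ltNge -[d < 1]subr_gt0 => h; rewrite ltNge; apply/negP => d1.
by move/negP: h; apply; rewrite mulr_le0_ge0 // addr_ge0 // sqr_ge0.
Qed.

Lemma cubic_split (C : closedFieldType) (a2 a1 a0 : C) :
  exists z1 z2 z3 : C, [/\ a2 = - (z1 + z2 + z3),
    a1 = z1 * z2 + z1 * z3 + z2 * z3 & a0 = - (z1 * z2 * z3)].
Proof.
(* [solve_monicpoly] equates z^n with the sum of the lower terms, hence the negated coefficients.
   The second call treats the quotient by X - z1. *)
have [z1 e1] := solve_monicpoly (nth 0 [:: - a0; - a1; - a2]) (isT : (0 < 3)%N).
pose b := a2 + z1; pose d := a1 + z1 * b.
have [z2 e2] := solve_monicpoly (nth 0 [:: - d; - b]) (isT : (0 < 2)%N).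
rewrite !big_ord_recr big_ord0 /= in e1;
  rewrite !big_ord_recr big_ord0 /= in e2.
have e2' : d = - (z2 ^+ 2 + b * z2) by rewrite e2; ring.
have ea1 : a1 = d - z1 * b by rewrite /d; ring.
have ea0 : a0 = - (z1 * d).
  have -> : a0 = - (z1 ^+ 3 + a2 * z1 ^+ 2 + a1 * z1) by rewrite e1; ring.
  by rewrite /d /b; ring.
exists z1, z2, (- b - z2); rewrite ea0 ea1 e2' /b; split; ring.
Qed.

Lemma decays_third_order (K : numFieldType) (z1 z2 z3 : K) (w : nat -> K) :
  `|z1| < 1 -> `|z2| < 1 -> `|z3| < 1 ->
  (forall k, w k.+3 = (z1 + z2 + z3) * w k.+2
     - (z1 * z2 + z1 * z3 + z2 * z3) * w k.+1 + z1 * z2 * z3 * w k) ->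
  decays w.
Proof.
move=> h1 h2 h3 ew.
(* With T the shift, v = (T - z3) w and u = (T - z2) v, and the hypothesis reads (T - z1) u = 0. *)
pose v k := w k.+1 - z3 * w k; pose u k := v k.+1 - z2 * v k.
have du : decays u.
  apply: (decays_first_order (v := fun=> 0) h1 _ (decays0 _)) => k.
  by rewrite /u /v ew; ring.
have dv : decays v by apply: (decays_first_order h2 _ du) =>
  k; rewrite /u; ring.
by apply: (decays_first_order h3 _ dv) => k; rewrite /v; ring.
Qed.

Lemma decays_real_cubic (R : rcfType) (a2 a1 a0 : R) (w : nat -> R[i]) :
  0 < 1 + a2 + a1 + a0 -> a2 + a0 < 1 + a1 -> `|a0| < 1 ->
  0 < 1 - a1 + a0 * a2 - a0 ^+ 2 ->
  (forall k, w k.+3 + a2%:C%C * w k.+2 + a1%:C%C * w k.+1 + a0%:C%C * w k =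
    0) ->
  decays w.
Proof.
move=> p1 pN1 ha0 D ew.
have [z1 [z2 [z3 [e2 e1 e0]]]] := cubic_split a2%:C%C a1%:C%C a0%:C%C.
have lt1 z : (z - z1) * (z - z2) * (z - z3) = 0 -> `|z| < 1.
  move=> zr; apply: (cubic_root_norm_lt1 p1 pN1 ha0 D); rewrite e2 e1 e0 -zr;
    ring.
apply: (@decays_third_order _ z1 z2 z3); try by apply: lt1; ring.
by move=> k; apply/eqP; rewrite -subr_eq0 -[X in _ == X](ew k) e2 e1 e0;
  apply/eqP; ring.
Qed.

(** * Singular modes *)

(** Intermediate values between [t] and a Cauchy-type bound [b]. In the necessity part, this
    supplies real eigenvalues of modulus at least 1. *)
Lemma cubic_root_ge (R : rcfType) (a2 a1 a0 t : R) :
  t ^+ 3 + a2 * t ^+ 2 + a1 * t + a0 <= 0 ->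
  exists2 l, t <= l & l ^+ 3 + a2 * l ^+ 2 + a1 * l + a0 = 0.
Proof.
move=> pt; pose p : {poly R} := 'X^3 + a2 *: 'X^2 + a1 *: 'X + a0%:P.
have pE x : p.[x] = x ^+ 3 + a2 * x ^+ 2 + a1 * x + a0 by rewrite /p !hornerE.
pose b := 1 + `|t| + `|a2| + `|a1| + `|a0|.
have [t0 a20 a10 a00] := And4 (normr_ge0 t) (normr_ge0 a2) (normr_ge0 a1)
  (normr_ge0 a0).
have tb : t <= b by rewrite (le_trans (ler_norm t)) // /b; lra.
have b1 : 1 <= b by rewrite /b; lra.
have pb : 0 <= p.[b].
  have h2 : - `|a2| * b ^+ 2 <= a2 * b ^+ 2
    by rewrite ler_wpM2r ?exprn_ge0 ?lerNnormlW //; lra.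
  have h1 : - `|a1| * b ^+ 2 <= a1 * b.
    have : - `|a1| * b <= a1 * b by rewrite ler_wpM2r ?lerNnormlW //; lra.
    by apply: le_trans; rewrite !mulNr lerN2 ler_wpM2l // expr2 ler_peMl //;
      lra.
  have h0 : - `|a0| * b ^+ 2 <= a0.
    apply: (le_trans (y := - `|a0|)); last exact: lerNnormlW.
    by rewrite mulNr lerN2 ler_peMr // exprn_ege1.
  have h3 : b ^+ 3 = b ^+ 2 + `|t| * b ^+ 2 + `|a2| * b ^+ 2 + `|a1| * b ^+ 2 +
    `|a0| * b ^+ 2.
    by rewrite exprS {1}/b; ring.
  have : 0 <= `|t| * b ^+ 2 by rewrite mulr_ge0 ?exprn_ge0 //; lra.
  have : 0 <= b ^+ 2 by rewrite sqr_ge0.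
  by rewrite pE h3; lra.
have [l /andP[tl _] /rootP pl] : exists2 x, t <= x <= b & root p x.
  by apply: poly_ivt => //; rewrite pE pt pb.
by exists l => //; rewrite -pE.
Qed.

(* The iteration of one singular mode: after rescaling, [u], [b] and [c] are
   the components of x, y and the extrapolated y along a pair of singular
   vectors, and s = alpha beta sigma^2. *)
Definition modal_recurrence (K : nzRingType) (gamma delta s : K)
    (u b c : nat -> K) : Prop :=
  forall k, [/\ u k.+1 = u k - s * c k,
    b k.+1 = b k + (u k - gamma * s * c k) &
    c k.+1 = b k + delta * (u k - gamma * s * c k)].

(* The three conditions say that the characteristic polynomial p of the modal
   recurrence has p(-1) < 0, that the product of the 1 - l_i l_j over pairs of
   its roots is positive, and that its roots have product > -1. *)
Definition stable_mode (R : realType) (gamma delta s : R) : Prop :=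
  [/\ (2 * gamma - 1) * (2 * delta - 1) * s < 4,
    0 < gamma + delta - 2 + (gamma - 1) * (delta - 1) * (gamma + delta - 1) * s
      &
    (gamma - 1) * (delta - 1) * s < 1].

Section Modes.
Variables (R : realType) (gamma delta s : R).
Hypothesis s_gt0 : 0 < s.

(** The modal matrix has characteristic polynomial X^3 + a2 X^2 + a1 X + a0. *)
Let a2 := gamma * delta * s - 2.
Let a1 := 1 - 2 * gamma * delta * s + (gamma + delta) * s.
Let a0 := (gamma - 1) * (delta - 1) * s.

Let D_eq : 1 - a1 + a0 * a2 - a0 ^+ 2 =
  s * (gamma + delta - 2 + (gamma - 1) * (delta - 1) * (gamma + delta - 1) * s).
Proof. by rewrite /a2 /a1 /a0; ring. Qed.

Lemma stable_mode_decays (u b c : nat -> R[i]) : 2 < gamma + delta ->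
  stable_mode gamma delta s ->
  modal_recurrence gamma%:C%C delta%:C%C s%:C%C u b c ->
    [/\ decays u, decays b & decays c].
Proof.
move=> S2 [pN1 D a0lt1] rec.
have p1 : 0 < 1 + a2 + a1 + a0.
  by move: s_gt0; congr (0 < _); rewrite /a2 /a1 /a0; ring.
have pN1' : a2 + a0 < 1 + a1.
  have e : (2 * gamma - 1) * (2 * delta - 1) * s = 4 + (a2 + a0 - (1 + a1)).
    by rewrite /a2 /a1 /a0; ring.
  by move: pN1; rewrite e; lra.
(* The upper bound is the third stability condition. The lower one comes from the second, whose
   expression equals [(gamma + delta - 1) * (1 + a0) - 1]. *)
have a0norm : `|a0| < 1.
  rewrite ltr_norml a0lt1 andbT.
  have e : gamma + delta - 2 + (gamma - 1) * (delta - 1) * (gamma + delta - 1)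
    * s
    = (gamma + delta - 1) * (1 + a0) - 1 by rewrite /a0; ring.
  have : 0 < (gamma + delta - 1) * (1 + a0) by move: D; rewrite e; lra.
  by rewrite pmulr_rgt0; lra.
have D' : 0 < 1 - a1 + a0 * a2 - a0 ^+ 2 by rewrite D_eq mulr_gt0.
have C2 : a2%:C%C = gamma%:C%C * delta%:C%C * s%:C%C - 2.
  by rewrite /a2; ring.
have C1 : a1%:C%C = 1 - 2 * gamma%:C%C * delta%:C%C * s%:C%C + (gamma%:C%C +
  delta%:C%C) * s%:C%C.
  by rewrite /a1; ring.
have C0 : a0%:C%C = (gamma%:C%C - 1) * (delta%:C%C - 1) * s%:C%C.
  by rewrite /a0; ring.
have recE k : [/\ u k.+1 = u k - s%:C%C * c k,
    b k.+1 = b k + (u k - gamma%:C%C * s%:C%C * c k) &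
    c k.+1 = b k + delta%:C%C * (u k - gamma%:C%C * s%:C%C * c k)] := rec k.
(* By Cayley-Hamilton each component satisfies the scalar recurrence of the characteristic
   polynomial; here this is checked by unfolding three steps. *)
split; apply: (decays_real_cubic p1 pN1' a0norm D') => k; rewrite C2 C1 C0;
  have [e1 e2 e3] := recE k; have [e1' e2' e3'] := recE k.+1;
  have [e1'' e2'' e3''] := recE k.+2;
  rewrite ?e1'' ?e2'' ?e3'' ?e1' ?e2' ?e3' ?e1 ?e2 ?e3; ring.
Qed.

End Modes.

Lemma stable_mode_real_decays (R : realType) (gamma delta s : R) (u b c :
  nat -> R) :
  0 < s -> 2 < gamma + delta -> stable_mode gamma delta s ->
  modal_recurrence gamma delta s u b c -> [/\ decays u, decays b & decays c].
Proof.
move=> s0 S2 st rec.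
have [] := @stable_mode_decays R gamma delta s s0
    (fun k => (u k)%:C%C) (fun k => (b k)%:C%C) (fun k => (c k)%:C%C) S2 st.
  move=> k; have [eu eb ec] := rec k.
  by split; rewrite ?eu ?eb ?ec; ring.
by move=> /decays_complex ? /decays_complex ? /decays_complex ?.
Qed.

(** * Necessity of the stability conditions for one mode *)

Section UnstableModes.
Variables (R : realType) (gamma delta s : R).
Hypothesis s_gt0 : 0 < s.

Let a2 := gamma * delta * s - 2.
Let a1 := 1 - 2 * gamma * delta * s + (gamma + delta) * s.
Let a0 := (gamma - 1) * (delta - 1) * s.

(** Since the extrapolated y starts at y_0, the initial modal states fill only the plane b = c. The
    two trajectories start along a basis of this plane, and each argument below must check that its
    form is nonzero there. *)
Variables (e f : R) (u b c u' b' c' : nat -> R).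
Hypotheses (e_neq0 : e != 0) (f_neq0 : f != 0).
Hypotheses (rec : modal_recurrence gamma delta s u b c)
           (rec' : modal_recurrence gamma delta s u' b' c').
Hypotheses (u0 : u 0%N = e) (b0 : b 0%N = 0) (c0 : c 0%N = 0).
Hypotheses (u'0 : u' 0%N = 0) (b'0 : b' 0%N = f) (c'0 : c' 0%N = f).
Hypotheses (du : decays u) (db : decays b) (dc : decays c).
Hypotheses (du' : decays u') (db' : decays b') (dc' : decays c').

(* A left eigenvector of the modal matrix for a root l <= -1 of its
   characteristic polynomial gives a non-decaying linear form. *)
Lemma decaying_modes_pN1 : (2 * gamma - 1) * (2 * delta - 1) * s < 4.
Proof.
rewrite ltNge; apply/negP => h.
(* This cubic is -p(-X), whose value at 1 is -p(-1); its root [m] is the opposite of a root of p. *)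
have [|m m1 pm] := @cubic_root_ge _ (- a2) a1 (- a0) 1.
  by move: h; rewrite -subr_le0; congr (_ <= 0); rewrite /a2 /a1 /a0; ring.
pose l := - m.
have pl : l ^+ 3 + a2 * l ^+ 2 + a1 * l + a0 = 0.
  by rewrite -[RHS]oppr0 -[in RHS]pm /l; ring.
pose W k := (1 + delta * (l - 1)) * u' k + (l - 1) * b' k + (l - 1) ^+ 2 * c' k.
have /eqP : W 0%N = 0.
  apply: (@decays_geometric_eq0 _ W l).
  - by rewrite normrN ger0_norm // (le_trans ler01).
  - move=> k; have [eu eb ec] := rec' k.
    (* The coefficients of [u'] and [b'] agree identically, that of [c'] only modulo p(l), which is
       therefore subtracted before [ring]. *)
    rewrite -[RHS]subr0 -[X in _ - X](mul0r (c' k)) -[X in X * c' k]pl /W eu eb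
      ec.
    by rewrite /a2 /a1 /a0; ring.
  - by do !apply: decaysD; apply: decaysZ.
have -> : W 0%N = f * (m * (m + 1)) by rewrite /W u'0 b'0 c'0 /l; ring.
by rewrite !mulf_eq0 (negPf f_neq0) /= => /orP[] /eqP; lra.
Qed.

(* The same idea applied to the second exterior power of the modal matrix,
   whose eigenvalues are the products of two distinct modal eigenvalues. *)
Lemma decaying_modes_pairs :
  0 < gamma + delta - 2 + (gamma - 1) * (delta - 1) * (gamma + delta - 1) * s.
Proof.
rewrite ltNge; apply/negP => h.
(* The cubic with roots l_i l_j, the characteristic polynomial of the second exterior power; its
   value at 1 is [s] times the expression in [h]. *)
have [|m m1 qm] := @cubic_root_ge _ (- a1) (a0 * a2) (- a0 ^+ 2) 1.
  move: h; rewrite -(pmulr_rle0 _ s_gt0); congr (_ <= 0).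
  by rewrite /a2 /a1 /a0; ring.
have m0 : m != 0 by rewrite gt_eqF // (lt_le_trans ltr01).
pose t := m + s * gamma * (delta - 1); pose w12 := t + (1 - delta) * s.
pose W k := w12 * (u k * b' k - b k * u' k)
  + (m * t - w12) * (u k * c' k - c k * u' k)
  + s * m * (b k * c' k - c k * b' k).
have dW : decays W.
  have dm x y x' y' : decays x -> decays y -> decays x' -> decays y' ->
      decays (fun k => x k * y' k - y k * x' k).
    move=> dx dy dx' dy'; apply: (@eq_decays _ (fun k =>
      x k * y' k + -1 * (y k * x' k))).
      by move=> k; rewrite mulN1r.
    by apply: decaysD; [|apply: decaysZ]; apply: decaysM.
  by do !apply: decaysD; apply: decaysZ; apply: dm.
have /eqP : W 0%N = 0.
  apply: (@decays_geometric_eq0 _ W m) => //; first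
    by rewrite ger0_norm // (le_trans ler01).
  move=> k; have [eu eb ec] := rec k; have [eu' eb' ec'] := rec' k.
  rewrite -[RHS]subr0 -[X in _ - X](mul0r (u k * c' k - c k * u' k)).
  rewrite -[X in X * (u k * c' k - c k * u' k)]qm /W eu eb ec eu' eb' ec'.
  by rewrite /w12 /t /a2 /a1 /a0; ring.
have -> : W 0%N = e * f * (m * t) by rewrite /W u0 b0 c0 u'0 b'0 c'0; ring.
rewrite !mulf_eq0 (negPf e_neq0) (negPf f_neq0) (negPf m0) /= => /eqP t0.
(* If [t] vanishes, the equation for [m] collapses to [(s * (1 - delta)) ^+ 2 = 0]; then [delta = 1]
   and [m = 0], against [1 <= m]. *)
have em : m = s * gamma * (1 - delta).
  by apply/eqP; rewrite -subr_eq0 -[X in _ == X]t0 /t; apply/eqP; ring.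
have : (s * (1 - delta)) ^+ 2 = 0.
  by rewrite -[RHS]oppr0 -[in RHS]qm em /a2 /a1 /a0; ring.
move/eqP; rewrite expf_eq0 /= mulf_eq0 gt_eqF //= => /eqP d1.
by move/eqP: m0; apply; rewrite em d1 mulr0.
Qed.

(* The determinant of three trajectories is multiplied by - a0 at each step;
   the third trajectory is the first one delayed. *)
Lemma decaying_modes_det : (gamma - 1) * (delta - 1) * s < 1.
Proof.
rewrite ltNge; apply/negP => h.
pose W k := u k * (b' k * c k.+1 + -1 * (b k.+1 * c' k))
  + -1 * (b k * (u' k * c k.+1 + -1 * (u k.+1 * c' k)))
  + c k * (u' k * b k.+1 + -1 * (u k.+1 * b' k)).
have /eqP : W 0%N = 0.
  apply: (@decays_geometric_eq0 _ W (- a0)).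
  - by rewrite normrN ger0_norm // (le_trans ler01).
  - move=> k; have [eu1 eb1 ec1] := rec k.+1.
    have [eu eb ec] := rec k; have [eu' eb' ec'] := rec' k.
    rewrite /W eu1 eb1 ec1 eu' eb' ec' eu eb ec.
    by rewrite /a0; ring.
  - have [su sb sc] := And3 (decays_shift du) (decays_shift db) (decays_shift
    dc).
    by rewrite /W; do 3?[apply: decaysD]; try apply: decaysZ; apply: decaysM =>
      //;
      apply: decaysD; try apply: decaysZ; apply: decaysM.
have [eu eb ec] := rec 0%N.
rewrite /W eu eb ec u0 b0 c0 u'0 b'0 c'0.
(* After one step the first trajectory is at (e, e, delta e). The determinant vanishes only for
   [delta = 1], when [h] reads [1 <= 0]. *)
rewrite (_ : _ + _ = e ^+ 2 * f * (delta - 1)); last by ring.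
rewrite !mulf_eq0 (negPf e_neq0) (negPf f_neq0) /= => /eqP d1.
by move: h; rewrite d1; lra.
Qed.

Lemma decaying_modes_stable : stable_mode gamma delta s.
Proof.
split; [exact: decaying_modes_pN1 | exact: decaying_modes_pairs | exact:
  decaying_modes_det].
Qed.

End UnstableModes.

(** * The stability region as a set of values of s *)

(** Suppose S = gamma + delta <= 2 and let c = (gamma - 1)(delta - 1). The cases S <= 1 and S <= 3/2
    are excluded by signs and by c s < 1. Otherwise, eliminating s between the first two conditions
    gives 2 - S < 4 c <= (2 - S)^2, impossible for 0 <= 2 - S < 1/2. *)
Lemma stable_mode_gt2 (R : realType) (gamma delta s : R) :
  0 <= gamma -> 0 <= delta -> 0 < s -> stable_mode gamma delta s ->
    2 < gamma + delta.
Proof.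
move=> g0 d0 s0 [p D a]; rewrite ltNge; apply/negP => S2.
set c := (gamma - 1) * (delta - 1) in D a.
have c4 : 4 * c <= (2 - gamma - delta) ^+ 2.
  rewrite -subr_ge0; have -> : (2 - gamma - delta) ^+ 2 - 4 * c =
    (gamma - delta) ^+ 2.
    by rewrite /c; ring.
  exact: sqr_ge0.
have p' : (4 * c + 2 * (gamma + delta) - 3) * s < 4.
  by move: p; congr (_ < _); rewrite /c; ring.
have pos : 0 < c * (gamma + delta - 1).
  by rewrite -(pmulr_lgt0 _ s0); move: D; lra.
have [S1|S1] := leP (gamma + delta) 1.
  have : 0 <= c by rewrite /c; nra.
  by nra.
have c0 : 0 < c by move: pos; rewrite pmulr_lgt0 //; lra.
have [S3|S3] := leP (2 * (gamma + delta)) 3; first by nra.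
have D' : 2 - gamma - delta < c * (gamma + delta - 1) * s by move: D; lra.
clearbody c; pose S := gamma + delta; rewrite -/S in p' pos S1 S2 S3.
have D2 : 2 - S < c * (S - 1) * s by move: D'; rewrite /S; lra.
have q0 : 0 < 4 * c + 2 * S - 3 by lra.
have h1 : (4 * c + 2 * S - 3) * (2 - S) < 4 * (c * (S - 1)).
  have h2 : (4 * c + 2 * S - 3) * (2 - S) < (4 * c + 2 * S - 3) * (c * (S - 1)
    * s).
    by rewrite ltr_pM2l.
  apply: (lt_trans h2).
  have -> : (4 * c + 2 * S - 3) * (c * (S - 1) * s) =
    (4 * c + 2 * S - 3) * s * (c * (S - 1)) by ring.
  by rewrite ltr_pM2r.
have h3 : (2 * S - 3) * (2 - S) < (2 * S - 3) * (4 * c).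
  by move: h1; rewrite -subr_gt0 -[in X in _ -> X]subr_gt0; congr (0 < _); ring.
have h4 : 2 - S < 4 * c by move: h3; rewrite ltr_pM2l //; lra.
have h5 : 4 * c <= (2 - S) ^+ 2 by move: c4; rewrite /S; congr (_ <= _); ring.
nra.
Qed.

(** Each condition has the form k s < m with m > 0, so it passes to smaller positive s. *)
Lemma stable_mode_le (R : realType) (gamma delta s t : R) :
  2 < gamma + delta -> 0 < s -> s <= t ->
  stable_mode gamma delta t -> stable_mode gamma delta s.
Proof.
move=> S2 s0 st [p D a].
have lin (k m : R) : 0 < m -> k * t < m -> k * s < m.
  move=> m0 km; have [k0|k0] := leP k 0.
    by apply: le_lt_trans m0; rewrite mulr_le0_ge0 // ltW.
  by apply: le_lt_trans km; rewrite ler_pM2l.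
split; [exact: lin|..|exact: lin].
set k := (gamma - 1) * (delta - 1) * (gamma + delta - 1) in D *.
have kt : - k * t < gamma + delta - 2
  by rewrite mulNr ltrNl -subr_gt0 opprK addrC.
have : - k * s < gamma + delta - 2 by apply: lin kt; rewrite subr_gt0.
by rewrite mulNr ltrNl -subr_gt0 opprK addrC.
Qed.

(** With S and c as above and A = 4 c + 2 S - 3, the thresholds 4 / A and (S - 2) / (- c (S - 1))
    are compared through the identity (S - 2) A + 4 c (S - 1) = (2 S - 3)(4 c + S - 2), whose last
    factor is the case distinction. *)
Lemma stable_modeE (R : realType) (gamma delta p q : R) :
  0 <= gamma -> 0 <= delta -> 2 < gamma + delta -> 0 < p -> 0 < q ->
  stable_mode gamma delta (p * q) <->
  (if 0 <= 4 * gamma * delta - 3 * (gamma + delta) + 2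
   then p < 4 / ((2 * gamma - 1) * (2 * delta - 1) * q)
   else p < (gamma + delta - 2) /
      (- ((gamma - 1) * (delta - 1) * (gamma + delta - 1) * q))).
Proof.
move=> g0 d0 S2 p0 q0.
pose s := p * q; have s0 : 0 < s by rewrite mulr_gt0.
pose S := gamma + delta; pose c := (gamma - 1) * (delta - 1).
pose A := (2 * gamma - 1) * (2 * delta - 1).
have A_c : A = 4 * c + 2 * S - 3 by rewrite /A /c /S; ring.
have caseE : 4 * gamma * delta - 3 * (gamma + delta) + 2 = 4 * c + S - 2.
  by rewrite /c /S; ring.
have stE : stable_mode gamma delta s <->
    [/\ A * s < 4, 0 < S - 2 + c * (S - 1) * s & c * s < 1] by [].
rewrite -/s stE caseE -/S -/c -/A -/S; rewrite -/S in S2; clear stE caseE.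
clearbody S c; case: ifPn => [h|]; last rewrite -ltNge => h.
  have A0 : 0 < A by rewrite A_c; lra.
  rewrite ltr_pdivlMr; last exact: mulr_gt0 A0 q0.
  have -> : p * (A * q) = A * s by rewrite /s; ring.
  split=> [[] //|As]; clearbody A s; subst A; split=> //; last by nra.
  have [c0|c0] := leP 0 c; first by rewrite ltr_wpDr // ?mulr_ge0 //; lra.
  have key : 4 * (- c) * (S - 1) <= (S - 2) * (4 * c + 2 * S - 3).
    rewrite -subr_ge0.
    have -> : (S - 2) * (4 * c + 2 * S - 3) - 4 * (- c) * (S - 1) =
      (2 * S - 3) * (4 * c + S - 2) by ring.
    by rewrite mulr_ge0 //; lra.
  rewrite -(pmulr_rgt0 _ A0).
  have c0' : 0 < - c * (S - 1) by rewrite mulr_gt0 //; lra.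
  have -> : (4 * c + 2 * S - 3) * (S - 2 + c * (S - 1) * s) =
      ((S - 2) * (4 * c + 2 * S - 3) - 4 * - c * (S - 1)) +
      (- c * (S - 1) * 4 - - c * (S - 1) * ((4 * c + 2 * S - 3) * s)) by ring.
  by rewrite ltr_wpDl ?subr_ge0 // subr_gt0 ltr_pM2l.
have c0 : c < 0 by lra.
have k0 : 0 < - (c * (S - 1)) by rewrite -mulNr mulr_gt0 //; lra.
rewrite ltr_pdivlMr; last by rewrite -mulNr pmulr_lgt0.
have -> : p * - (c * (S - 1) * q) = - (c * (S - 1)) * s by rewrite /s; ring.
split=> [[_ D _]|D]; first by lra.
clearbody A s; subst A; split; [|by lra|].
  have [A0|A0] := leP (4 * c + 2 * S - 3) 0.
    by apply: (@le_lt_trans _ _ 0); rewrite // mulr_le0_ge0 // ltW.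
  rewrite -(ltr_pM2l k0).
  have h1 : (4 * c + 2 * S - 3) * (- (c * (S - 1)) * s) < (4 * c + 2 * S - 3) *
    (S - 2).
    by rewrite ltr_pM2l.
  have h2 : (2 * S - 3) * (4 * c + S - 2) < 0 by rewrite pmulr_rlt0 //; lra.
  have -> : - (c * (S - 1)) * ((4 * c + 2 * S - 3) * s) =
    (4 * c + 2 * S - 3) * (- (c * (S - 1)) * s) by ring.
  apply: (lt_trans h1); rewrite -subr_lt0; move: h2; congr (_ < _); ring.
by apply: (@lt_trans _ _ 0) => //; rewrite nmulr_rlt0.
Qed.

Lemma stable_mode_exists (R : realType) (gamma delta : R) :
  2 < gamma + delta -> exists2 s, 0 < s & stable_mode gamma delta s.
Proof.
(* [m] is below both 1 and [gamma + delta - 2], so the three conditions hold as soon as each of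
   their s-terms has modulus less than [m]. *)
move=> S2; pose m := (gamma + delta - 2) / (gamma + delta - 1).
have S1 : 0 < gamma + delta - 1 by lra.
have m0 : 0 < m by rewrite divr_gt0 // subr_gt0.
have m1 : m < 1 by rewrite ltr_pdivrMr // mul1r; lra.
have mS : m < gamma + delta - 2 by rewrite ltr_pdivrMr // ltr_pMr; lra.
pose k1 := (2 * gamma - 1) * (2 * delta - 1).
pose k2 := (gamma - 1) * (delta - 1) * (gamma + delta - 1).
pose k3 := (gamma - 1) * (delta - 1).
pose q := 1 + `|k1| + `|k2| + `|k3|.
have [h1 h2 h3] := And3 (normr_ge0 k1) (normr_ge0 k2) (normr_ge0 k3).
have q0 : 0 < q by rewrite /q; lra.
have e0 : 0 < m / q by rewrite divr_gt0.
have small k : `|k| < q -> - m < k * (m / q) < m.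
  move=> kq; rewrite -ltr_norml normrM (gtr0_norm e0).
  by rewrite -[ltRHS](divfK (lt0r_neq0 q0)) mulrC ltr_pM2l.
have [/andP[_ b1] /andP[b2 _] /andP[_ b3]] : [/\ - m < k1 * (m / q) < m,
    - m < k2 * (m / q) < m & - m < k3 * (m / q) < m].
  by split; apply: small; rewrite /q; lra.
exists (m / q) => //; split; rewrite -/k1 -/k2 -/k3; lra.
Qed.

(** * Gram matrices *)

(** The spectral theorem over [R[i]] gives a real diagonal form; real matrices similar over [R[i]]
    are similar through a real matrix. *)
Lemma symmetric_diagonalizable (R : rcfType) n (S : 'M[R]_n) : S^T = S ->
  exists2 P : 'M[R]_n, P \in unitmx &
    exists D : 'rV[R]_n, P *m S = diag_mx D *m P.
Proof.
move=> symS; pose f := real_complex R; pose Sc : 'M[R[i]]_n := map_mx f S.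
have realI m p (A : 'M[R[i]]_(m, p)) : A \is a mxOver Num.real ->
    exists A' : 'M[R]_(m, p), A = map_mx f A'.
  move=> /mxOverP Ar; exists (map_mx (@complex.Re R) A); apply/matrixP => i j.
  by rewrite !mxE /f RRe_real.
have Sreal : Sc \is a mxOver Num.real.
  by apply/mxOverP => i j; rewrite mxE; apply/complex_realP; exists (S i j).
have Sherm : Sc \is hermsymmx.
  apply: realsym_hermsym Sreal; apply/is_hermitianmxP.
  by rewrite expr0 scale1r map_mx_id // /Sc map_trmx symS.
have /orthomx_spectralP eS := hermitian_normalmx Sherm.
have Dreal := hermitian_spectral_diag_real Sherm.
have [D eD] := realI _ _ _ Dreal.
have diag_real : diag_mx (spectral_diag Sc) \is a mxOver Num.real.
  by rewrite eD; apply/mxOverP => i j; rewrite !mxE rpredMn //;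
    apply/complex_realP; exists (D ord0 i).
have [|P /andP[Preal Punit]] := real_similar _ Sreal diag_real.
  exists (spectralmx Sc); first exact: spectral_unit.
  apply/similarP; first exact: spectral_unit.
  have := congr1 (mulmx (spectralmx Sc)) eS.
  by rewrite !mulmxA mulmxV ?spectral_unit // mul1mx.
move=> /(similarP Punit).
have [P' eP] := realI _ _ _ Preal.
rewrite eP eD /Sc -map_diag_mx -!map_mxM => /map_mx_inj e.
exists P'; last by exists D.
by move: Punit; rewrite eP map_unitmx.
Qed.

Lemma diagonalization_rows (F : fieldType) n (S P : 'M[F]_n) (D : 'rV[F]_n) i :
  P \in unitmx -> P *m S = diag_mx D *m P ->
  row i P *m S = D ord0 i *: row i P /\ eigenvalue S (D ord0 i).
Proof.
move=> Pu PD.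
have ei : row i P *m S = D ord0 i *: row i P.
  rewrite -row_mul PD; apply/rowP => j; rewrite !mxE (bigD1 i) //= big1 ?addr0.
    by rewrite mxE eqxx mulr1n.
  by move=> k ki; rewrite mxE eq_sym (negPf ki) mulr0n mul0r.
split=> //; apply/eigenvalueP; exists (row i P) => //.
by apply/eqP => Pi0; have := row_free_unit P; rewrite Pu =>
  /row_freeP [Q /(congr1 (row i))];
  rewrite row_mul Pi0 mul0mx => /rowP /(_ i) /eqP;
    rewrite !mxE eqxx eq_sym oner_eq0.
Qed.

Lemma mulmx_trmx_eq0 (R : realDomainType) m n (A : 'M[R]_(m, n)) :
  A^T *m A = 0 -> A = 0.
Proof.
move=> A0; apply/matrixP => i j; rewrite mxE.
have /matrixP /(_ j j) := A0; rewrite !mxE.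
under eq_bigr do rewrite mxE -expr2.
move/eqP; rewrite psumr_eq0; last by move=> k _; exact: sqr_ge0.
by move=> /allP /(_ i (mem_index_enum _)) /=; rewrite sqrf_eq0 => /eqP.
Qed.

(* A matrix and its Gram matrix have the same kernel, hence row space. *)
Lemma gram_factor (R : realFieldType) m n (A : 'M[R]_(m, n)) :
  exists D : 'M[R]_(m, n), A = D *m (A^T *m A).
Proof.
suff /submxP [D eD] : (A <= A^T *m A)%MS by exists D.
rewrite submxE; apply/eqP/mulmx_trmx_eq0.
set Z := cokermx _; have Z0 : A^T *m A *m Z = 0 by rewrite mulmx_coker.
by rewrite trmx_mul -mulmxA (mulmxA A^T) Z0 mulmx0.
Qed.

Lemma gram_eigenvalue_ge0 (R : realFieldType) m n (A : 'M[R]_(m, n)) (a : R) :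
  eigenvalue (A^T *m A) a -> 0 <= a.
Proof.
move=> /eigenvalueP [v ev v0].
have sq p (w : 'rV[R]_p) : (w *m w^T) ord0 ord0 = \sum_j w ord0 j ^+ 2.
  by rewrite mxE; apply: eq_bigr => j _; rewrite mxE expr2.
have e : ((v *m A^T) *m (v *m A^T)^T) ord0 ord0 = a * (v *m v^T) ord0 ord0.
  rewrite trmx_mul trmxK mulmxA -(mulmxA v) ev -scalemxAl.
  by rewrite [LHS]mxE.
rewrite !sq in e.
have v_gt0 : 0 < \sum_j v ord0 j ^+ 2.
  have vge : 0 <= \sum_j v ord0 j ^+ 2 by apply: sumr_ge0 =>
    j _; exact: sqr_ge0.
  rewrite lt_neqAle vge andbT eq_sym psumr_eq0; last
    by move=> j _; exact: sqr_ge0.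
  apply: contraNN v0 => /allP h; apply/eqP/rowP => j; rewrite mxE.
  by have := h j (mem_index_enum _); rewrite /= sqrf_eq0 => /eqP.
rewrite -(pmulr_lge0 _ v_gt0) -e.
by apply: sumr_ge0 => j _; exact: sqr_ge0.
Qed.

(** [D] is a generalized inverse of [A^T]: insert [A^T = A^T *m A *m D^T], the transposed
    factorization. This makes the limit points equilibria. *)
Lemma gram_projection (R : realFieldType) m n (A D : 'M[R]_(m, n)) :
  A = D *m (A^T *m A) -> A^T *m D *m A^T = A^T.
Proof.
move=> eD; have eT : A^T = A^T *m A *m D^T
  by rewrite [in LHS]eD !trmx_mul trmxK.
by rewrite {2}eT mulmxA -(mulmxA A^T) -eD -eT.
Qed.

(** * Alex-GDA on a bilinear game *)

Lemma derive_of_linear (R : realType) n (g : 'cV[R]_n -> R^o) (v x : 'cV[R]_n) :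
  (forall (a : R) y z, g (a *: y + z) = a * g y + g z) -> 'D_v g x = g v.
Proof.
move=> glin; apply: cvg_lim; first exact: Rhausdorff.
apply: cvg_near_cst; near=> h.
have h0 : h != 0 by near: h; exact: nbhs_dnbhs_neq.
by rewrite /= glin addrK /GRing.scale /= mulrA mulVf // mul1r.
Unshelve. all: by end_near.
Qed.

Section VectorDecay.
Variable R : realType.

Definition vdecays n (w : nat -> 'cV[R]_n) : Prop :=
  forall i, decays (fun k => w k i ord0).

Lemma vdecays_mulmx m n (A : 'M[R]_(m, n)) (w : nat -> 'cV[R]_n) :
  vdecays w -> vdecays (fun k => A *m w k).
Proof.
move=> dw i; apply: eq_decays (decays_sum (index_enum _) (w := fun j k =>
  A i j * w k j ord0) _).
  by move=> k; rewrite mxE.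
by move=> j; apply: decaysZ.
Qed.

Lemma normr_le_euclidean_norm n (v : 'cV[R]_n) i :
  `|v i ord0| <= euclidean_norm v.
Proof.
rewrite -sqrtr_sqr ler_wsqrtr // (bigD1 i) //= lerDl.
by apply: sumr_ge0 => j _; exact: sqr_ge0.
Qed.

Lemma euclidean_norm_le_sum n (v : 'cV[R]_n) :
  euclidean_norm v <= \sum_i `|v i ord0|.
Proof.
set T := \sum_i _; have T0 : 0 <= T by apply: sumr_ge0.
rewrite -[leRHS]ger0_norm // -sqrtr_sqr ler_wsqrtr // expr2 {1}/T mulr_suml.
apply: ler_sum => i _; rewrite -(real_normK (num_real _)) expr2 ler_wpM2l //.
by rewrite /T (bigD1 i) //= lerDl sumr_ge0.
Qed.

Lemma vdecaysP n (w : nat -> 'cV[R]_n) :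
  vdecays w <-> decays (fun k => euclidean_norm (w k)).
Proof.
split=> dw.
  apply: (le_decays _ (decays_sum (index_enum _) (fun i =>
    decays_norm (dw i)))) => k.
  by rewrite !ger0_norm ?sqrtr_ge0 ?euclidean_norm_le_sum ?sumr_ge0.
move=> i; apply: le_decays dw => k.
by rewrite (le_trans (normr_le_euclidean_norm _ i)) ?ler_norm.
Qed.

Lemma vdecays_col_mx m n (w : nat -> 'cV[R]_m) (v : nat -> 'cV[R]_n) :
  vdecays (fun k => col_mx (w k) (v k)) <-> vdecays w /\ vdecays v.
Proof.
split=> [d|[dw dv] i].
  split=> i.
    by apply: eq_decays (d (lshift n i)) => k; rewrite col_mxEu.
  by apply: eq_decays (d (rshift m i)) => k; rewrite col_mxEd.
case: (split_ordP i) => j ->.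
  by apply: eq_decays (dw j) => k; rewrite col_mxEu.
by apply: eq_decays (dv j) => k; rewrite col_mxEd.
Qed.

End VectorDecay.

Section BilinearGame.
Variables (R : realType) (dx dy : nat) (B : 'M[R]_(dx, dy)).

Lemma gradient_x_bilinear x y : gradient_x (bilinear_game B) x y = B *m y.
Proof.
apply/colP => i; rewrite mxE derive_of_linear => [|a u v].
  by rewrite /bilinear_game trmx_delta -mulmxA -rowE mxE.
by rewrite /bilinear_game raddfD /= linearZ /= !mulmxDl -!scalemxAl !mxE.
Qed.

Lemma gradient_y_bilinear x y : gradient_y (bilinear_game B) x y = B^T *m x.
Proof.
apply/colP => i; rewrite mxE derive_of_linear => [|a u v].
  by rewrite /bilinear_game -colE mxE -[B^T *m x]trmxK trmx_mul trmxK [RHS]mxE.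
by rewrite /bilinear_game mulmxDr -scalemxAr !mxE.
Qed.

Lemma nash_bilinearP x y :
  nash_equilibrium (bilinear_game B) x y <-> B^T *m x = 0 /\ B *m y = 0.
Proof.
have sq0 n (w : 'cV[R]_n) : (w^T *m w) ord0 ord0 <= 0 -> w = 0.
  move=> w0; apply: mulmx_trmx_eq0; apply/matrixP => i j; rewrite !ord1.
  rewrite [RHS]mxE; apply/le_anti/andP; split; first exact: w0.
  rewrite mxE; apply: sumr_ge0 => k _.
  by rewrite mxE -expr2 sqr_ge0.
split=> [[hv hu]|[Bx By]].
  split; apply: sq0.
    (* A unilateral move along the player's own gradient changes f by the squared norm of that
       gradient. *)
    have := hv (y + B^T *m x).
    by rewrite /bilinear_game mulmxDr mxE gerDl trmx_mul trmxK.
  have := hu (x - B *m y); rewrite /bilinear_game raddfB /= !mulmxBl.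
  have -> (M N : 'M[R]_1) : (M - N) ord0 ord0 = M ord0 ord0 - N ord0 ord0.
    by rewrite !mxE.
  by rewrite -subr_ge0 addrAC subrr sub0r oppr_ge0 mulmxA.
have f0 u : bilinear_game B u y = 0
  by rewrite /bilinear_game -mulmxA By mulmx0 mxE.
have f0' v : bilinear_game B x v = 0.
  by rewrite /bilinear_game -[x^T *m B]trmxK trmx_mul trmxK Bx trmx0 mul0mx mxE.
by split=> ?; rewrite !f0 ?f0'.
Qed.

End BilinearGame.

(** * From single modes to trajectories and back *)

Section Dynamics.
Variables (R : realType) (dx dy : nat) (B : 'M[R]_(dx, dy)).
Variables (gamma delta alpha beta : R).

Section Trajectory.
Variables (x0 : 'cV[R]_dx) (y0 : 'cV[R]_dy).

Let state k := alex_gda (bilinear_game B) gamma delta alpha beta x0 y0 k.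
Definition gda_x k := (state k).1.1.
Definition gda_y k := (state k).1.2.
Definition gda_yt k := (state k).2.

Let xt k := gda_x k - (gamma * alpha) *: (B *m gda_yt k).

Lemma gda_recurrence k :
  [/\ gda_x k.+1 = gda_x k - alpha *: (B *m gda_yt k),
    gda_y k.+1 = gda_y k + beta *: (B^T *m xt k) &
    gda_yt k.+1 = gda_y k + (delta * beta) *: (B^T *m xt k)].
Proof.
rewrite /xt /gda_x /gda_y /gda_yt /state /alex_gda iterS.
case: (iter k _ _) => [[x y] yt] /=.
by rewrite !gradient_x_bilinear !gradient_y_bilinear.
Qed.

Lemma linearly_converges_to_nashP :
  linearly_converges_to_nash (bilinear_game B) gamma delta alpha beta x0 y0 <->
  exists xs ys, [/\ B^T *m xs = 0, B *m ys = 0,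
    vdecays (fun k => gda_x k - xs) & vdecays (fun k => gda_y k - ys)].
Proof.
have eqv xs ys k (t : R) :
    (let: (x, y, _) := state k in euclidean_norm (col_mx (x - xs) (y - ys)) <=
      t) =
    (`|euclidean_norm (col_mx (gda_x k - xs) (gda_y k - ys))| <= t) :> bool.
  rewrite /gda_x /gda_y; case: (state k) => [[x y] yt] /=.
  by rewrite ger0_norm // sqrtr_ge0.
split.
  move=> [xs [ys [/nash_bilinearP [Bx By] [M [rho [M0 r0 r1 h]]]]]].
  exists xs, ys; suff /vdecays_col_mx [] : vdecays (fun k =>
    col_mx (gda_x k - xs) (gda_y k - ys)) by [].
  by apply/vdecaysP; exists M, rho; split=> // k; rewrite -eqv; exact: h.
move=> [xs [ys [Bx By dX dY]]]; exists xs, ys; split;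
  first exact/nash_bilinearP.
have /vdecaysP [M [rho [M0 r0 r1 h]]] := (vdecays_col_mx _ _).2 (conj dX dY).
by exists M, rho; split=> // k; rewrite eqv; exact: h.
Qed.

(** [p *m B^T] is an unnormalized left singular direction; the factor [beta] on the x component
    leaves only the product [alpha * beta * a] in the recurrence. *)
Lemma modal_projection (p : 'rV[R]_dy) (a : R) : p *m (B^T *m B) = a *: p ->
  modal_recurrence gamma delta (alpha * beta * a)
    (fun k => beta * (p *m B^T *m gda_x k) ord0 ord0)
    (fun k => (p *m gda_y k) ord0 ord0)
    (fun k => (p *m gda_yt k) ord0 ord0).
Proof.
move=> ep k; have [eX eY eT] := gda_recurrence k.
have Bgrad v : p *m B^T *m (B *m v) = a *: (p *m v).
  by rewrite -!mulmxA (mulmxA B^T) mulmxA ep scalemxAl.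
have addE (M N : 'M[R]_1) : (M + N) ord0 ord0 = M ord0 ord0 + N ord0 ord0
  by rewrite mxE.
have oppE (M : 'M[R]_1) : (- M) ord0 ord0 = - M ord0 ord0 by rewrite mxE.
have sclE t (M : 'M[R]_1) : (t *: M) ord0 ord0 = t * M ord0 ord0 by rewrite mxE.
have extrap t : (p *m (gda_y k + t *: (B^T *m xt k))) ord0 ord0 =
    (p *m gda_y k) ord0 ord0 + t * ((p *m B^T *m gda_x k) ord0 ord0
      - gamma * alpha * (a * (p *m gda_yt k) ord0 ord0)).
  rewrite mulmxDr -scalemxAr mulmxA /xt mulmxBr -scalemxAr Bgrad.
  by rewrite !(addE, oppE, sclE).
split; first by rewrite eX mulmxBr -scalemxAr Bgrad !(addE, oppE, sclE); ring.
  by rewrite eY extrap; ring.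
by rewrite eT extrap; ring.
Qed.

End Trajectory.

Lemma stable_modes_converge : 0 < alpha -> 0 < beta -> 2 < gamma + delta ->
  (forall a, eigenvalue (B^T *m B) a -> 0 < a ->
    stable_mode gamma delta (alpha * beta * a)) ->
  globally_linearly_converges (bilinear_game B) gamma delta alpha beta.
Proof.
move=> a0 b0 S2 st x0 y0; apply/linearly_converges_to_nashP.
pose S := B^T *m B; pose X := gda_x x0 y0; pose Y := gda_y x0 y0.
have symS : S^T = S by rewrite /S trmx_mul trmxK.
have [P Punit [D PD]] := symmetric_diagonalizable symS.
have [F eF] := gram_factor B; have [E eE] := gram_factor B^T;
  rewrite trmxK in eE.
have BT_F : B^T = S *m F^T by rewrite [in LHS]eF trmx_mul symS.
have rowP i : row i P *m S = D ord0 i *: row i P :=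
  (diagonalization_rows i Punit PD).1.
have eigD i : eigenvalue S (D ord0 i) := (diagonalization_rows i Punit PD).2.
have rowE0 (v : 'cV[R]_dy) i : (P *m v) i ord0 = (row i P *m v) ord0 ord0.
  by rewrite -row_mul [RHS]mxE.
have modes i : decays (fun k => (P *m (B^T *m X k)) i ord0) /\
               decays (fun k => (P *m (S *m Y k)) i ord0).
  have := gram_eigenvalue_ge0 (eigD i); rewrite le_eqVlt => /orP[/eqP Di0|Di0].
    (* For eigenvalue 0 the row annihilates [S] and hence [B^T = S *m F^T], so both projections are
       identically zero. *)
    have pS : row i P *m S = 0 by rewrite rowP -Di0 scale0r.
    split; apply: (eq_decays _ (decays0 _)) => k; rewrite rowE0 mulmxA.
      by rewrite BT_F mulmxA pS !mul0mx mxE.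
    by rewrite pS mul0mx mxE.
  have [|du db _] := stable_mode_real_decays _ S2 (st _ (eigD i) Di0)
    (modal_projection x0 y0 (rowP i)).
    by rewrite !mulr_gt0.
  split.
    apply: eq_decays (decaysZ beta^-1 du) => k.
    by rewrite rowE0 mulKf ?gt_eqF // mulmxA.
  apply: eq_decays (decaysZ (D ord0 i) db) => k.
  by rewrite rowE0 mulmxA rowP -scalemxAl [RHS]mxE.
have unP w : vdecays (fun k => P *m w k) -> vdecays w.
  move=> /(vdecays_mulmx (invmx P)) dw i; apply: eq_decays (dw i) => k.
  by rewrite mulKmx.
have dU : vdecays (fun k => B^T *m X k) by apply: unP => i; have [] := modes i.
have dS : vdecays (fun k => S *m Y k) by apply: unP => i; have [] := modes i.
(* The x steps lie in the column space of [B], on which [F *m B^T] acts as the identity. *)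
have X_F k : X k - F *m (B^T *m X k) = x0 - F *m (B^T *m x0).
  elim: k => // k <-; have [eX _ _] := gda_recurrence x0 y0 k.
  rewrite /X eX -/(X k); set v := gda_yt _ _ _.
  have FB : F *m (B^T *m (B *m v)) = B *m v by rewrite !mulmxA -(mulmxA F) -eF.
  by rewrite !mulmxBr -!scalemxAr FB opprB addrA subrK.
have Y_E k : Y k - E *m (B *m Y k) = y0 - E *m (B *m y0).
  elim: k => // k <-; have [_ eY _] := gda_recurrence x0 y0 k.
  rewrite /Y eY -/(Y k); set v := gda_x _ _ _ - _; clearbody v.
  have EB : E *m (B *m (B^T *m v)) = B^T *m v
    by rewrite !mulmxA -(mulmxA E) -eE.
  by rewrite !mulmxDr -!scalemxAr EB opprD addrACA subrr addr0.
exists (x0 - F *m (B^T *m x0)), (y0 - E *m (B *m y0)); split.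
- by rewrite mulmxBr !mulmxA gram_projection // subrr.
- have := @gram_projection _ _ _ B^T E; rewrite !trmxK => /(_ eE) eBE.
  by rewrite mulmxBr !mulmxA eBE subrr.
- move=> i; apply: eq_decays (vdecays_mulmx F dU i) => k.
  by rewrite -(X_F k) subKr.
(* Here [B *m Y k] is recovered from the decaying [S *m Y k] as [F *m (S *m Y k)]. *)
- move=> i; apply: eq_decays (vdecays_mulmx E (vdecays_mulmx F dS) i) => k.
  by rewrite -(Y_E k) subKr [F *m _]mulmxA -eF.
Qed.

Lemma converging_mode_stable a : 0 < alpha -> 0 < beta ->
  globally_linearly_converges (bilinear_game B) gamma delta alpha beta ->
  eigenvalue (B^T *m B) a -> 0 < a ->
    stable_mode gamma delta (alpha * beta * a).
Proof.
move=> a0 b0 conv /eigenvalueP [p ep p0] apos.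
set s := alpha * beta * a; have s0 : 0 < s by rewrite !mulr_gt0.
have pp : (p *m p^T) ord0 ord0 != 0.
  apply: contra_neq p0 => pp0; apply: trmx_inj; rewrite trmx0; apply:
    mulmx_trmx_eq0.
  by rewrite trmxK; apply/matrixP => i j; rewrite (ord1 i) (ord1 j) [RHS]mxE.
pose u x0 y0 k := beta * (p *m B^T *m gda_x x0 y0 k) ord0 ord0.
pose b x0 y0 k := (p *m gda_y x0 y0 k) ord0 ord0.
pose c x0 y0 k := (p *m gda_yt x0 y0 k) ord0 ord0.
have rec x0 y0 : modal_recurrence gamma delta s (u x0 y0) (b x0 y0) (c x0 y0).
  exact: modal_projection ep.
have dec x0 y0 : [/\ decays (u x0 y0), decays (b x0 y0) & decays (c x0 y0)].
  have /linearly_converges_to_nashP [xs [ys [Bx By dX dY]]] := conv x0 y0.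
  have du : decays (u x0 y0).
    apply: eq_decays (decaysZ beta (vdecays_mulmx (p *m B^T) dX ord0)) => k.
    by rewrite mulmxBr -[p *m B^T *m xs]mulmxA Bx mulmx0 subr0.
  have db : decays (b x0 y0).
    have pys : p *m ys = 0.
      apply: (scalerI (lt0r_neq0 apos)).
      by rewrite scalemxAl -ep -!mulmxA By !mulmx0 scaler0.
    apply: eq_decays (vdecays_mulmx p dY ord0) => k.
    by rewrite mulmxBr pys subr0.
  (* Convergence concerns x and y only; the extrapolated component is recovered as c_k = (u_k -
     u_{k+1}) / s. *)
  split=> //; apply: eq_decays (decaysZ s^-1 (decaysD du (decaysZ (-1)
    (decays_shift du)))) => k.
  have [-> _ _] := rec x0 y0 k.
  by rewrite mulN1r opprB addrCA subrr addr0 mulKf // gt_eqF.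
(* These two initializations project to the modal states (e, 0, 0) and (0, f, f), with f = |p|^2 and
   e = beta a |p|^2. *)
have [du db dc] := dec (B *m p^T) 0; have [du' db' dc'] := dec 0 p^T.
apply: (decaying_modes_stable s0 (e := beta * (a * (p *m p^T) ord0 ord0))
  (f := (p *m p^T) ord0 ord0) _ _ (rec (B *m p^T) 0) (rec 0 p^T)) => //.
- by rewrite mulf_neq0 ?(lt0r_neq0 b0) ?mulf_neq0 ?(lt0r_neq0 apos).
- rewrite /u /gda_x /=; congr (_ * _).
  by rewrite -!mulmxA (mulmxA B^T) mulmxA ep -scalemxAl [LHS]mxE.
- by rewrite /b /gda_y /= mulmx0 mxE.
- by rewrite /c /gda_yt /= mulmx0 mxE.
- by rewrite /u /gda_x /= mulmx0 mxE mulr0.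
Qed.

End Dynamics.

(** If [L] were 0, all eigenvalues of the diagonalizable Gram matrix would vanish, and so would
    [B]. *)
Lemma largest_singular_value_gt0 (R : realType) dx dy (B : 'M[R]_(dx, dy)) L :
  B != 0 -> largest_singular_value B L -> 0 < L.
Proof.
move=> B0 [[a ea eL] maxL]; rewrite eL lt_neqAle eq_sym sqrtr_ge0 andbT -eL.
apply: contraNneq B0 => L0.
have symS : (B^T *m B)^T = B^T *m B by rewrite trmx_mul trmxK.
have [P Punit [D PD]] := symmetric_diagonalizable symS.
have D0 : D = 0.
  apply/rowP => i; rewrite mxE; have [_ eigD] :=
    diagonalization_rows i Punit PD.
  have Dge := gram_eigenvalue_ge0 eigD; apply/le_anti; rewrite Dge andbT.
  by rewrite -sqrtr_eq0 eq_le sqrtr_ge0 andbT -L0 maxL //; exists (D ord0 i).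
apply/eqP/mulmx_trmx_eq0; rewrite -[LHS](mulKmx Punit) PD D0.
by rewrite raddf0 mul0mx mulmx0.
Qed.

Theorem theorem6p1 (R : realType) (dx dy : nat) (B : 'M[R]_(dx, dy))
    (Lxy gamma delta : R)
    (B_neq0 : B != 0) (hLxy : largest_singular_value B Lxy)
    (gamma_ge0 : 0 <= gamma) (delta_ge0 : 0 <= delta) :
  ((exists alpha beta : R, [/\ 0 < alpha, 0 < beta &
      globally_linearly_converges (bilinear_game B) gamma delta alpha beta])
   <-> 2 < gamma + delta) /\
  (2 < gamma + delta ->
   forall alpha beta : R, 0 < alpha -> 0 < beta ->
   (globally_linearly_converges (bilinear_game B) gamma delta alpha beta
    <->
    if 0 <= 4 * gamma * delta - 3 * (gamma + delta) + 2
    then alpha * beta < 4 / ((2 * gamma - 1) * (2 * delta - 1) * Lxy ^+ 2)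
    else alpha * beta <
      (gamma + delta - 2) /
      (- ((gamma - 1) * (delta - 1) * (gamma + delta - 1) * Lxy ^+ 2)))).
Proof.
have L0 := largest_singular_value_gt0 B_neq0 hLxy.
have L2 : 0 < Lxy ^+ 2 by rewrite exprn_gt0.
have [[a ea eL] maxL] := hLxy.
have eigL : eigenvalue (B^T *m B) (Lxy ^+ 2).
  by rewrite eL sqr_sqrtr // (gram_eigenvalue_ge0 ea).
have necessary alpha beta : 0 < alpha -> 0 < beta ->
    globally_linearly_converges (bilinear_game B) gamma delta alpha beta ->
    stable_mode gamma delta (alpha * beta * Lxy ^+ 2).
  by move=> a0 b0 conv; apply: converging_mode_stable eigL L2.
have sufficient alpha beta : 2 < gamma + delta -> 0 < alpha -> 0 < beta ->
    stable_mode gamma delta (alpha * beta * Lxy ^+ 2) ->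
    globally_linearly_converges (bilinear_game B) gamma delta alpha beta.
  (* Every eigenvalue [t] of the Gram matrix is at most [Lxy ^+ 2], so stability passes down to its
     mode. *)
  move=> S2 a0 b0 st; apply: stable_modes_converge => // t et t0.
  apply: stable_mode_le st => //; first by rewrite !mulr_gt0.
  rewrite ler_pM2l ?mulr_gt0 // -[leLHS]sqr_sqrtr ?(ltW t0) //.
  by rewrite lerXn2r ?nnegrE ?sqrtr_ge0 ?(ltW L0) // maxL //; exists t.
have criterion alpha beta : 2 < gamma + delta -> 0 < alpha -> 0 < beta ->
    globally_linearly_converges (bilinear_game B) gamma delta alpha beta <->
      _ :=
  fun S2 a0 b0 => iff_trans (conj (necessary _ _ a0 b0) (sufficient _ _ S2 a0
    b0))
    (stable_modeE gamma_ge0 delta_ge0 S2 (mulr_gt0 a0 b0) L2).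
split; last by move=> S2 alpha beta a0 b0; exact: criterion.
split=> [[alpha [beta [a0 b0 /(necessary _ _ a0 b0)]]]|S2].
  by apply: stable_mode_gt2 => //; rewrite !mulr_gt0.
have [e e0 st] := stable_mode_exists S2.
exists 1, (e / Lxy ^+ 2); split=> //; first exact: divr_gt0.
by apply: sufficient; rewrite ?divr_gt0 // mul1r divfK ?gt_eqF.
Qed.
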